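(* For any $\varepsilon\in(0,1)$, any $C>0$ and any $r>0$, there exists an $\mathcal{H}^2$-rectifiable, star-shaped, relatively closed and essentially closed Borel set $J\subset B^3_{2r}$ with the following properties: (i) $\mathcal{H}^{2}(J)<\varepsilon(2r)^{2}$. (ii) There exists $h_0\in\mathbb{N}$ such that $$\mathcal{H}^2\Big(J\cap\big(B^3_R\setminus B^3_{R(1-2^{-h_0})}\big)\Big)\ge C\,\varepsilon\,\delta_{h_0}^2,\qquad \delta_{h_0}:=R\,2^{-h_0},$$ for every $R\in(r,2r)$.
   Context: $B^3_t$ denotes the open ball of radius $t$ in $\mathbb{R}^3$ centred at the origin. $\mathcal{H}^2$ is two-dimensional Hausdorff measure. A set is $\mathcal{H}^2$-rectifiable if it is countably $\mathcal{H}^2$-rectifiable and has finite $\mathcal{H}^2$-measure. Relatively closed means closed in $B^3_{2r}$; essentially closed means $\mathcal{H}^2(\overline{J}\setminus J)=0$. *)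

(* Defs.v *)
From HB Require Import structures.
From mathcomp Require Import all_boot all_order all_algebra.
From mathcomp Require Import all_classical all_reals all_analysis.

Set Implicit Arguments.
Unset Strict Implicit.
Unset Printing Implicit Defensive.

Import Order.TTheory GRing.Theory Num.Theory.
Import numFieldNormedType.Exports.

Local Open Scope classical_set_scope.
Local Open Scope ring_scope.

(* The library norm on row vectors is the sup norm, so everything metric below
   is stated with the Euclidean norm. The two norms induce the same topology,
   hence [open], [closed] and [closure] are the usual ones. *)
Definition enorm (R : realType) (n : nat) (x : 'rV[R]_n) : R :=
  Num.sqrt (\sum_(i < n) x ord0 i ^+ 2).

Definition eball (R : realType) (n : nat) (t : R) : set 'rV[R]_n :=
  [set x | enorm x < t].
Arguments eball {R} n t.

(* Adjoining 0 gives the empty set diameter 0 instead of -oo. *)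
Definition diam (R : realType) (n : nat) (A : set 'rV[R]_n) : \bar R :=
  ereal_sup ([set 0%E] `|`
    [set d | exists x y, [/\ A x, A y & d = (enorm (x - y))%:E]]).

(* The factor omega_2 / 2 ^ 2 = pi / 4, with omega_2 the area of the unit disc,
   is the normalisation that makes the Hausdorff measure of dimension 2 agree
   with the Lebesgue measure on the plane. *)
Definition hausdorff2_pre (R : realType) (n : nat) (delta : R)
    (A : set 'rV[R]_n) : \bar R :=
  ereal_inf [set m | exists F : nat -> set 'rV[R]_n,
    [/\ A `<=` \bigcup_k F k,
        forall k, (diam (F k) <= delta%:E)%E &
        m = (\sum_(0 <= k <oo) (pi / 4)%:E * diam (F k) ^+ 2)%E]].

(* [hausdorff2_pre delta A] increases as [delta] decreases to 0, so its limit
   is its supremum. *)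
Definition hausdorff2 (R : realType) (n : nat) (A : set 'rV[R]_n) : \bar R :=
  ereal_sup [set hausdorff2_pre delta A | delta in [set delta | 0 < delta]].

Definition elipschitz (R : realType) (m n : nat)
    (f : 'rV[R]_m -> 'rV[R]_n) : Prop :=
  exists L : R, forall x y, enorm (f x - f y) <= L * enorm (x - y).

Definition countably_rectifiable2 (R : realType) (n : nat)
    (A : set 'rV[R]_n) : Prop :=
  exists f : nat -> 'rV[R]_2 -> 'rV[R]_n,
    (forall k, elipschitz (f k)) /\
    hausdorff2 (A `\` \bigcup_k range (f k)) = 0%E.

Definition rectifiable2 (R : realType) (n : nat) (A : set 'rV[R]_n) : Prop :=
  countably_rectifiable2 A /\ (hausdorff2 A < +oo)%E.

Definition star_shaped (R : realType) (n : nat) (A : set 'rV[R]_n) : Prop :=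
  exists2 x0, A x0 &
    forall x t, A x -> 0 <= t <= 1 -> A ((1 - t) *: x0 + t *: x).

Definition closed_in (R : realType) (n : nat) (B A : set 'rV[R]_n) : Prop :=
  exists2 F, closed F & A = F `&` B.

Definition essentially_closed (R : realType) (n : nat)
    (A : set 'rV[R]_n) : Prop :=
  hausdorff2 (closure A `\` A) = 0%E.

Definition borel_set (R : realType) (n : nat) (A : set 'rV[R]_n) : Prop :=
  <<s [set U : set 'rV[R]_n | open U] >> A.

(* Main.v *)
Require Import Defs.
From HB Require Import structures.
From mathcomp Require Import all_boot all_order all_algebra.
From mathcomp Require Import all_classical all_reals all_analysis.
From mathcomp Require Import ring lra.

Set Implicit Arguments.
Unset Strict Implicit.
Unset Printing Implicit Defensive.

Import Order.TTheory GRing.Theory Num.Theory.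
Import numFieldNormedType.Exports.

Local Open Scope classical_set_scope.
Local Open Scope ring_scope.

(* With t = 2^-j small, take for J the flat compact triangle of vertices 0,
   (a, 0, 0) and (a, t a, 0), where a = 2r (1 - t^2 / 2) is just small enough
   for J to fit inside the open ball of radius 2r. Its area is O(r^2 t). For
   h_0 = 2j the shell of radius R has thickness R t^2, but its part in J
   contains the rectangle [R (1 - t^2), R (1 - t^2 / 2)] x [0, R t / 2], because
   a sphere of radius R only recedes by O(R t^2) over a height R t. The area
   R^2 t^3 / 4 of this rectangle dominates R^2 t^4. No sharp constant is needed,
   so H^2 is bounded above by covering with small squares, and below by the
   planar Lebesgue measure of a projection. *)

(** * Euclidean norm in coordinates *)

Section enorm.
Context {R : realType}.

Lemma ler_coord_enorm n (x : 'rV[R]_n) i : `|x ord0 i| <= enorm x.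
Proof.
rewrite -sqrtr_sqr /enorm ler_wsqrtr// (bigD1 i)//= lerDl.
by apply: sumr_ge0 => j _; exact: sqr_ge0.
Qed.

Lemma enorm2E (x : 'rV[R]_2) :
  enorm x = Num.sqrt (x ord0 0 ^+ 2 + x ord0 1 ^+ 2).
Proof.
rewrite /enorm !big_ord_recl big_ord0 addr0.
by congr (Num.sqrt (_ ^+ 2 + x _ _ ^+ 2)); apply/val_inj.
Qed.

Lemma enorm3E (x : 'rV[R]_3) :
  enorm x = Num.sqrt (x ord0 0 ^+ 2 + x ord0 1 ^+ 2 + x ord0 ord_max ^+ 2).
Proof.
rewrite /enorm !big_ord_recl big_ord0 addr0 addrA.
by congr (Num.sqrt (_ ^+ 2 + x _ _ ^+ 2 + x _ _ ^+ 2)); apply/val_inj.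
Qed.

End enorm.

(** * Diameter and two-dimensional Hausdorff measure *)

Section hausdorff.
Context {R : realType}.

Lemma diam_ge0 n (A : set 'rV[R]_n) : (0 <= diam A)%E.
Proof. by apply: ereal_sup_ubound; left. Qed.

Lemma diam_le n (A : set 'rV[R]_n) (c : R) : 0 <= c ->
  (forall x y, A x -> A y -> enorm (x - y) <= c) -> (diam A <= c%:E)%E.
Proof.
move=> c0 Ac; apply: ge_ereal_sup => _ [->|[x [y [Ax Ay ->]]]].
  by rewrite lee_fin.
by rewrite lee_fin Ac.
Qed.

Lemma enorm_le_diam n (A : set 'rV[R]_n) x y :
  A x -> A y -> ((enorm (x - y))%:E <= diam A)%E.
Proof. by move=> Ax Ay; apply: ereal_sup_ubound; right; exists x, y. Qed.

Lemma hausdorff2_pre_le n (A : set 'rV[R]_n) (delta : R) :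
  0 < delta -> (hausdorff2_pre delta A <= hausdorff2 A)%E.
Proof. by move=> d0; apply: ereal_sup_ubound; exists delta. Qed.

Lemma hausdorff2_ge0 n (A : set 'rV[R]_n) : (0 <= hausdorff2 A)%E.
Proof.
apply: le_trans (hausdorff2_pre_le A ltr01).
apply: le_ereal_inf_tmp => _ [F [_ _ ->]].
apply: nneseries_ge0 => k _ _; apply: mule_ge0.
  by rewrite lee_fin divr_ge0// pi_ge0.
by rewrite expe_ge0// diam_ge0.
Qed.

(** A finite cover padded with empty sets, of diameter 0, is a countable cover with the same sum;
    since [c] does not depend on [delta], the bound passes to the supremum. *)
Lemma hausdorff2_le_finite_cover n (A : set 'rV[R]_n) (c : R) :
  (forall delta : R, 0 < delta -> exists N (s : R) (F : nat -> set 'rV[R]_n),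
    [/\ A `<=` \bigcup_(k < N) F k, 0 <= s <= delta,
        forall k, (k < N)%N -> (diam (F k) <= s%:E)%E &
        N%:R * (pi / 4 * s ^+ 2) <= c]) ->
  (hausdorff2 A <= c%:E)%E.
Proof.
move=> H; apply: ge_ereal_sup => _ [delta /= d0 <-].
have [N [s [F [AF /andP[s0 sd] Fs Nc]]]] := H _ d0.
have diam0 : diam (@set0 'rV[R]_n) = 0%E.
  apply/eqP; rewrite eq_le diam_ge0 andbT.
  by apply: diam_le => // x y [].
pose G k := if (k < N)%N then F k else set0.
apply: (@le_trans _ _
    (\sum_(0 <= k <oo) (pi / 4)%:E * diam (G k) ^+ 2)%E).
  apply: ereal_inf_lbound; exists G; split => //.
  - by move=> x /AF[k /= kN Fx]; exists k => //; rewrite /G kN.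
  - move=> k; rewrite /G; case: ifPn => kN; last by rewrite diam0 lee_fin ltW.
    by rewrite (le_trans (Fs k kN))// lee_fin.
have p0 : 0 <= pi / 4 :> R by rewrite divr_ge0// pi_ge0.
have t0 k : (0 <= (pi / 4)%:E * diam (G k) ^+ 2)%E.
  by rewrite mule_ge0 ?lee_fin ?expe_ge0 ?diam_ge0.
rewrite (nneseries_split 0 N)// add0n eseries0 ?adde0; last first.
  by move=> i Ni _; rewrite /G ltnNge Ni/= diam0 !mule0.
apply: (@le_trans _ _ (N%:R * (pi / 4 * s ^+ 2))%:E); last by rewrite lee_fin.
rewrite big_mkord; apply: (@le_trans _ _ (\sum_(i < N) (pi / 4 * s ^+ 2)%:E)%E).
  apply: lee_sum => i _; rewrite [leRHS]EFinM lee_pmul ?lee_fin ?expe_ge0 ?diam_ge0//.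
  by rewrite EFin_expe lee_sqr ?diam_ge0 ?lee_fin// /G ltn_ord Fs.
by rewrite sumEFin lee_fin sumr_const card_ord mulr_natl.
Qed.

Lemma hausdorff2_set0 n : hausdorff2 (@set0 'rV[R]_n) = 0%E.
Proof.
apply/eqP; rewrite eq_le hausdorff2_ge0 andbT.
apply: hausdorff2_le_finite_cover => delta d0.
exists 0%N, 0, (fun=> set0); split=> //; last by rewrite mul0r.
by rewrite lexx ltW.
Qed.

Lemma closed_borel_set n (A : set 'rV[R]_n) : closed A -> borel_set A.
Proof.
move=> cA; rewrite -[A]setCK -setTD.
apply: sigma_algebraCD; apply: sub_sigma_algebra.
exact: closed_openC.
Qed.

Lemma closed_essentially_closed n (A : set 'rV[R]_n) :
  closed A -> essentially_closed A.
Proof.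
by move=> /closure_id cA; rewrite /essentially_closed -cA setDv hausdorff2_set0.
Qed.

(** * Upper bound by grids of small squares *)

Lemma grid_cell (N : nat) (s x : R) : (0 < N)%N -> 0 <= x <= N%:R * s ->
  exists2 i : nat, (i < N)%N & i%:R * s <= x <= i.+1%:R * s.
Proof.
case: N => // N _; elim: N x => [|N IH] x /andP[x0 xN].
  by exists 0%N => //; rewrite mul0r x0.
have [xl|xg] := leP x (N.+1%:R * s).
  have [i iN xi] := IH x (introT andP (conj x0 xl)).
  by exists i => //; rewrite ltnW.
by exists N.+1 => //; rewrite ltW.
Qed.

(** Cutting an [m * w] by [w] rectangle into [m * k * k] squares of side [w / k] and diameter
    [sqrt 2 * w / k] gives the sum [pi / 2 * m * w ^ 2] for every [k], so the mesh can be refined at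
    no cost. *)
Lemma hausdorff2_planar_rect_le (A : set 'rV[R]_3) (m : nat) (w : R) :
  (0 < m)%N -> 0 <= w ->
  (forall p, A p -> [/\ 0 <= p ord0 0 <= m%:R * w, 0 <= p ord0 1 <= w
                      & p ord0 ord_max = 0]) ->
  (hausdorff2 A <= (pi / 2 * m%:R * w ^+ 2)%:E)%E.
Proof.
move=> m0 w0 Ap; apply: hausdorff2_le_finite_cover => delta d0.
(* This choice of [k] makes the diagonal of a cell at most [delta]. *)
have [k [k0 wk]] : exists k : nat, (0 < k)%N /\ Num.sqrt 2 * w / delta <= k%:R.
  exists (Num.truncn (Num.sqrt 2 * w / delta)).+1; split => //.
  by apply/ltW/truncnS_gt.
have k0' : 0 < k%:R :> R by rewrite ltr0n.
pose s := w / k%:R; have s0 : 0 <= s by rewrite divr_ge0// ltW.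
have ks : k%:R * s = w by rewrite /s mulrC divfK// gt_eqF.
(* Division by [k] encodes a cell as one number: the quotient is its index along the first axis, the
   remainder its index along the second. *)
pose F q := [set p : 'rV[R]_3 |
  [/\ (q %/ k)%:R * s <= p ord0 0 <= (q %/ k).+1%:R * s,
      (q %% k)%:R * s <= p ord0 1 <= (q %% k).+1%:R * s
    & p ord0 ord_max = 0]].
exists (m * k * k)%N, (Num.sqrt 2 * s), F; split.
- move=> p /Ap [px py pz].
  have [||i im xi] := @grid_cell (m * k)%N s (p ord0 0) _.
  + by rewrite muln_gt0 m0.
  + by rewrite natrM -mulrA ks.
  have [//||j jk yj] := @grid_cell k s (p ord0 1) _; first by rewrite ks.
  exists (i * k + j)%N => /=.
    rewrite (@leq_trans (i * k + k)%N) ?ltn_add2l// -mulSnr.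
    by rewrite leq_mul2r im orbT.
  by rewrite /F /= divnMDl// divn_small// addn0 modnMDl modn_small.
- rewrite mulr_ge0 ?sqrtr_ge0//= /s mulrA ler_pdivrMr// [leRHS]mulrC.
  by rewrite -ler_pdivrMr// (le_trans _ wk).
- move=> q _; apply: diam_le; first by rewrite mulr_ge0 ?sqrtr_ge0.
  move=> x y [x0 x1 x2] [y0 y1 y2].
  rewrite -[s]ger0_norm// -sqrtr_sqr -sqrtrM// enorm3E ler_wsqrtr// !mxE.
  rewrite x2 y2 subrr expr0n addr0 mulr_natl mulr2n.
  move: x0 x1 y0 y1; rewrite -!natr1 !mulrDl !mul1r.
  move: (_ * s) (_ * s) => a b.
  by move=> /andP[? ?] /andP[? ?] /andP[? ?] /andP[? ?];
    rewrite lerD// -[s ^+ 2]real_normK ?num_real// -[leLHS]real_normK ?num_real//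
      lerXn2r ?nnegrE// ler_norml ger0_norm//; lra.
- clearbody s F; rewrite exprMn sqr_sqrtr// -ks !natrM.
  by rewrite le_eqVlt; apply/orP; left; apply/eqP; field.
Qed.

(** * Lower bound by the area of a projection *)

Lemma lebesgue_measure_itvcc (a b : R) : a <= b ->
  lebesgue_measure `[a, b] = (b - a)%:E.
Proof.
move=> ab; rewrite lebesgue_measure_itv/= lte_fin.
have [//|ba] := ltP a b.
by rewrite (@le_anti _ _ a b) ?subrr// ab ba.
Qed.

Lemma area_rect (a b c d : R) : a <= b -> c <= d ->
  (lebesgue_measure \x lebesgue_measure)%E (`[a, b] `*` `[c, d]) =
  ((b - a) * (d - c))%:E.
Proof.
move=> ab cd; rewrite product_measure1E//.
by rewrite EFinM -!lebesgue_measure_itvcc.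
Qed.

(* A set of diameter [d] projects into a square of side [2 * d] centred at the
   projection of any of its points, which costs a factor [4] in the area. *)
Lemma hausdorff2_ge_projected_rect n (A : set 'rV[R]_n) (i j : 'I_n)
    (a b c d : R) : a <= b -> c <= d ->
  (forall x y, a <= x <= b -> c <= y <= d ->
    exists2 p, A p & p ord0 i = x /\ p ord0 j = y) ->
  ((pi / 16 * ((b - a) * (d - c)))%:E <= hausdorff2 A)%E.
Proof.
move=> ab cd Apr; apply: le_trans (hausdorff2_pre_le A ltr01).
apply: le_ereal_inf_tmp => _ [F [AF F1 ->]].
(* All diameters are at most 1, the scale at which the premeasure is taken, so they are real
   numbers. *)
pose e k := fine (diam (F k)).
have eE k : (e k)%:E = diam (F k).
  rewrite fineK// ge0_fin_numE ?diam_ge0//.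
  by rewrite (le_lt_trans (F1 k))// ltry.
have e0 k : 0 <= e k by rewrite fine_ge0// diam_ge0.
(* For an empty [F k] the default 0 is harmless: [p k] is used as a point of [F k] only once some
   [q] in [F k] is known. *)
pose p k := xget 0 (F k).
pose Q k : set (R * R) :=
  `[p k ord0 i - e k, p k ord0 i + e k] `*`
  `[p k ord0 j - e k, p k ord0 j + e k].
have QE k : (lebesgue_measure \x lebesgue_measure)%E (Q k) =
    (4%:E * (diam (F k) ^+ 2))%E.
  have := e0 k => ek.
  rewrite area_rect; [|lra|lra].
  by rewrite -eE -EFin_expe -EFinM; congr EFin; ring.
have /(@measure_sigma_subadditive _ R _
    (lebesgue_measure \x lebesgue_measure)%E) : forall k, measurable (Q k).
  by move=> k; apply: measurableX; exact: measurable_itv.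
move=> /(_ (`[a, b] `*` `[c, d])) H.
have : (((b - a) * (d - c))%:E <=
    \sum_(0 <= k <oo) (4%:E * diam (F k) ^+ 2))%E.
  rewrite -area_rect// -(eq_eseriesr (fun k _ => QE k)); apply: H.
    by apply: measurableX; exact: measurable_itv.
  move=> [x y] /= [xab ycd].
  rewrite !in_itv/= in xab ycd.
  have [q /AF[k _ Fq] [<- <-]] := Apr x y xab ycd.
  have Fp : F k (p k) by apply: xgetPex; exists q.
  have : enorm (q - p k) <= e k by rewrite -lee_fin eE enorm_le_diam.
  move=> qp; have D l : `|q ord0 l - p k ord0 l| <= e k.
    by apply: le_trans qp; have := ler_coord_enorm (q - p k) l; rewrite !mxE.
  by exists k => //; split => /=; rewrite in_itv/= -ler_distl D.
(* The factor [pi / 16] turns the area [4 * d ^ 2] of a square into the Hausdorff weight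
   [pi / 4 * d ^ 2]. *)
have p0 : 0 <= pi / 16 :> R by rewrite divr_ge0// pi_ge0.
move=> /(lee_wpmul2l (x := (pi / 16)%:E)); rewrite lee_fin => /(_ p0).
rewrite -EFinM -nneseriesZl; last first.
  by move=> k _; rewrite mule_ge0 ?expe_ge0 ?diam_ge0.
congr (_ <= _)%E; apply: eq_eseriesr => k _.
by rewrite muleA -EFinM; congr (_%:E * _)%E; field.
Qed.

End hausdorff.

(** * Flat sets and the triangle in space *)

Section flat_triangle.
Context {R : realType}.

Definition flat_point (x y : R) : 'rV[R]_3 := \row_i [:: x; y; 0]`_i.

Lemma flat_pointP (p : 'rV[R]_3) : p ord0 ord_max = 0 ->
  flat_point (p ord0 0) (p ord0 1) = p.
Proof.
move=> p2; apply/rowP => -[[|[|[|//]]] i3]; rewrite mxE/= -?p2;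
  by congr (p _ _); apply/val_inj.
Qed.

Lemma enorm_flat_point x y :
  enorm (flat_point x y) = Num.sqrt (x ^+ 2 + y ^+ 2).
Proof. by rewrite enorm3E !mxE/= expr0n addr0. Qed.

Lemma elipschitz_flat_point :
  elipschitz (fun v : 'rV[R]_2 => flat_point (v ord0 0) (v ord0 1)).
Proof.
exists 1 => u v; rewrite mul1r enorm2E enorm3E !mxE/=.
by rewrite subrr expr0n addr0.
Qed.

(** A single isometric copy of the plane already contains the whole set, so the part left uncovered
    is empty. *)
Lemma flat_rectifiable (A : set 'rV[R]_3) :
  (forall p, A p -> p ord0 ord_max = 0) -> countably_rectifiable2 A.
Proof.
move=> A0; exists (fun=> fun v => flat_point (v ord0 0) (v ord0 1)); split.
  by move=> _; exact: elipschitz_flat_point.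
rewrite (_ : A `\` _ = set0) ?hausdorff2_set0//.
apply/seteqP; split => // p [Ap]; apply; exists 0%N => //.
exists (\row_i [:: p ord0 0; p ord0 1]`_i) => //=.
by rewrite !mxE/= flat_pointP// A0.
Qed.

Definition flat_triangle (t a : R) : set 'rV[R]_3 :=
  [set p | [/\ p ord0 0 <= a, 0 <= p ord0 1, p ord0 1 <= t * p ord0 0
             & p ord0 ord_max = 0]].

Lemma closed_flat_triangle t a : closed (flat_triangle t a).
Proof.
have coordC i : continuous (fun p : 'rV[R]_3 => p ord0 i : R^o).
  exact: coord_continuous.
rewrite (_ : flat_triangle t a =
    (fun p : 'rV[R]_3 => p ord0 0 : R^o) @^-1` [set x | x <= a] `&`
    ((fun p : 'rV[R]_3 => p ord0 1 : R^o) @^-1` [set x | 0 <= x] `&`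
    ((fun p : 'rV[R]_3 => t * p ord0 0 - p ord0 1 : R^o) @^-1` [set x | 0 <= x]
     `&`
     (fun p : 'rV[R]_3 => p ord0 ord_max : R^o) @^-1` [set x | x = 0]))).
  apply: closedI.
    by apply: preimage_closed; [move=> x _; exact: coordC|exact: closed_le].
  apply: closedI.
    by apply: preimage_closed; [move=> x _; exact: coordC|exact: closed_ge].
  apply: closedI; last first.
    by apply: preimage_closed; [move=> x _; exact: coordC|exact: closed_eq].
  apply: preimage_closed; last exact: closed_ge.
  move=> x _; apply: (@cvgB _ R^o); last exact: coordC.
    exact: (nbhs_filter x).
  by apply: cvgMl_tmp; [exact: (nbhs_filter x)|exact: coordC].
apply/seteqP; split => p /=; rewrite subr_ge0.
  by move=> [? ? ? ?]; do !split.
by move=> [? [? [? ?]]]; split.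
Qed.

(** The vertex [(a, t * a, 0)] is the farthest from the origin, with squared norm
    [a ^ 2 * (1 + t ^ 2)]. *)
Lemma flat_triangle_sub_eball t a s : 0 < t -> 0 <= a ->
  a ^+ 2 * (1 + t ^+ 2) < s ^+ 2 -> 0 < s -> flat_triangle t a `<=` eball 3 s.
Proof.
move=> t0 a0 as2 s0 p [pa p1 p1t p2].
rewrite /eball/= enorm3E p2 expr0n addr0 -[ltRHS]gtr0_norm// -sqrtr_sqr.
rewrite ltr_sqrt ?exprn_gt0//; apply: le_lt_trans as2.
have p0 : 0 <= p ord0 0 by rewrite -(pmulr_rge0 _ t0) (le_trans p1).
rewrite mulrDr mulr1 -exprMn lerD// lerXn2r ?nnegrE ?mulr_ge0//.
  exact: ltW.
by rewrite (le_trans p1t)// mulrC ler_pM2r.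
Qed.

(** The centre is the vertex 0: every defining condition survives scaling by a factor in [0, 1]. *)
Lemma star_shaped_flat_triangle t a : 0 <= a -> star_shaped (flat_triangle t a).
Proof.
move=> a0; exists 0; first by split; rewrite ?mxE ?mulr0.
move=> x s [xa x1 x1t x2] /andP[s0 s1]; rewrite scaler0 add0r.
split; rewrite !mxE.
(* The sign of [t] is free here, so the first coordinate may be negative; its multiple is then at
   most 0, hence at most [a]. *)
- have [x0|x0] := leP 0 (x ord0 0); first by rewrite (le_trans _ xa)// ler_piMl.
  by rewrite (le_trans _ a0)// mulr_ge0_le0// ltW.
- exact: mulr_ge0.
- by rewrite mulrCA ler_wpM2l.
- by rewrite x2 mulr0.
Qed.

End flat_triangle.

(** * Choice of the parameters and verification of the properties *)

Theorem propositionC1 (R : realType) (eps C r : R)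
    (heps : 0 < eps < 1) (hC : 0 < C) (hr : 0 < r) :
  exists J : set 'rV[R]_3,
    [/\ J `<=` eball 3 (2 * r), borel_set J & rectifiable2 J] /\
    [/\ star_shaped J, closed_in (eball 3 (2 * r)) J & essentially_closed J] /\
    (hausdorff2 J < (eps * (2 * r) ^+ 2)%:E)%E /\
    exists h0 : nat, forall rho : R, r < rho < 2 * r ->
      ((C * eps * (rho * 2 ^- h0) ^+ 2)%:E <=
       hausdorff2 (J `&` (eball 3 rho `\` eball 3 (rho * (1 - 2 ^- h0)))))%E.
Proof.
case/andP: heps => eps0 eps1.
have pi2 := pi_ge2 R; have pi0 := pi_gt0 R.
(* The bound [eps / pi] serves the upper estimate of the measure, [1 / 2] the inclusions between
   triangle, rectangle and balls, and [1 / (32 * C)] the lower estimate in the shell. *)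
pose e := Num.min (eps / pi) (Num.min 2^-1 (C * 32)^-1).
have e0 : 0 < e by rewrite !lt_min !invr_gt0 divr_gt0 ?mulr_gt0 ?ltr0n.
have [j _ je] := near_infty_natSinv_expn_lt (PosNum e0).
have {je} := je j (leqnn _); rewrite /= div1r.
have t0 : 0 < 2 ^- j :> R by rewrite invr_gt0 exprn_gt0.
have mt : (2 ^ j)%:R * 2 ^- j = 1 :> R by rewrite natrX divff// expf_neq0.
have tt : 2 ^- (j * 2) = (2 ^- j) ^+ 2 :> R by rewrite exprM exprVn.
move: tt mt t0; set t := 2 ^- j; clearbody t => tt mt t0.
rewrite !lt_min => /and3P[t1 t2 t3].
have {}t1 : pi * t < eps by rewrite mulrC -ltr_pdivlMr.
have {}t3 : 32 * C * t < 1.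
  by rewrite mulrC -ltr_pdivlMr ?mulr_gt0// div1r [32 * C]mulrC.
have tsq0 : 0 < t ^+ 2 by rewrite exprn_gt0.
have tsq1 : t ^+ 2 < t / 2 by rewrite expr2 ltr_pM2l.
pose a := 2 * r * (1 - t ^+ 2 / 2).
have a0 : 0 <= a by rewrite /a mulr_ge0//; lra.
have a2r : a <= 2 * r by rewrite /a ger_pMr; lra.
pose J := flat_triangle t a.
(* With [u = t ^ 2], the farthest vertex is inside since [(1 - u / 2) ^ 2 * (1 + u) = 1 - 3 * u ^ 2
   / 4 + u ^ 3 / 4 < 1]. *)
have JB : J `<=` eball 3 (2 * r).
  apply: flat_triangle_sub_eball => //; last by rewrite mulr_gt0.
  rewrite /a exprMn -mulrA gtr_pMr ?exprn_gt0 ?mulr_gt0//.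
  move: tsq0 tsq1 t2; move: (t ^+ 2) => u; nra.
have Jeps : (hausdorff2 J < (eps * (2 * r) ^+ 2)%:E)%E.
  (* The triangle lies in a [2 * r] by [2 * r * t] rectangle, whose sides have ratio exactly [2 ^ j]
     because [2 ^ j * t = 1]. *)
  apply: le_lt_trans (hausdorff2_planar_rect_le
    (m := (2 ^ j)%N) (w := 2 * r * t) _ _ _) _.
  - by rewrite expn_gt0.
  - by rewrite !mulr_ge0// ltW.
  - move=> p [pa p1 p1t p2].
    have p0 : 0 <= p ord0 0 by rewrite -(pmulr_rge0 _ t0) (le_trans p1).
    rewrite mulrCA mt mulr1 p0 p1/=; split => //; first exact: le_trans a2r.
    by rewrite (le_trans p1t)// mulrC ler_pM2r// (le_trans pa).
  - rewrite lte_fin (_ : _ * _ = pi * t / 2 * (2 * r) ^+ 2 * ((2 ^ j)%:R * t)).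
      by rewrite mt mulr1 ltr_pM2r ?exprn_gt0 ?mulr_gt0//; lra.
    by field.
have Jclosed : closed J by exact: closed_flat_triangle.
exists J; split; first split=> //; first exact: closed_borel_set.
  split; first by apply: flat_rectifiable => p [].
  exact: lt_trans Jeps (ltry _).
split; first split.
- exact: star_shaped_flat_triangle.
- by exists J => //; apply/esym/setIidPl.
- exact: closed_essentially_closed.
split=> //; exists (j * 2)%N => rho /andP[rrho rho2]; rewrite tt.
have rho0 : 0 < rho by exact: lt_trans rrho.
apply: le_trans (hausdorff2_ge_projected_rect (i := 0) (j := 1)
  (a := rho * (1 - t ^+ 2)) (b := rho * (1 - t ^+ 2 / 2))
  (c := 0) (d := rho * (t / 2)) _ _ _).
- rewrite lee_fin.
  rewrite (_ : pi / 16 * _ = rho ^+ 2 * t ^+ 3 * (pi / 64)); last by field.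
  rewrite (_ : C * eps * _ = rho ^+ 2 * t ^+ 3 * (C * t * eps)); last by ring.
  rewrite ler_pM2l ?mulr_gt0 ?exprn_gt0//.
  (* What remains is [C * t * eps <= pi / 64], which follows from [C * t < 1 / 32] and [pi >= 2]. *)
  have : C * t * eps <= C * t by rewrite ger_pMr ?mulr_gt0// ltW.
  lra.
- by rewrite ler_pM2l//; lra.
- by rewrite mulr_ge0 ?ltW// divr_gt0.
move=> x y /andP[xa xb] /andP[y0 yb].
have x0 : 0 <= x by apply: le_trans xa; rewrite mulr_ge0 ?ltW//; lra.
exists (flat_point x y); last by rewrite !mxE.
split; [|split].
- rewrite /J /flat_triangle /= !mxE/=; split=> //.
  + by rewrite (le_trans xb)// /a ler_pM2r; lra.
  + rewrite (le_trans yb)//.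
    (* The rectangle stays below the hypotenuse, already at its left side, because
       [1 / 2 <= 1 - t ^ 2]. *)
    apply: (@le_trans _ _ (t * (rho * (1 - t ^+ 2)))); last by rewrite ler_pM2l.
    by rewrite !mulrA [t * rho]mulrC -!mulrA !ler_pM2l//; lra.
- rewrite /eball/= enorm_flat_point -[ltRHS]gtr0_norm// -sqrtr_sqr.
  rewrite ltr_sqrt ?exprn_gt0//.
  (* The far corner of the rectangle is inside the outer sphere: with [u = t ^ 2], [(1 - u / 2) ^ 2
     + u / 4 = 1 - 3 * u / 4 + u ^ 2 / 4 < 1]. *)
  apply: (@le_lt_trans _ _
    ((rho * (1 - t ^+ 2 / 2)) ^+ 2 + (rho * (t / 2)) ^+ 2)).
    by rewrite lerD// lerXn2r ?nnegrE// ?(le_trans x0 xb) ?(le_trans y0 yb).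
  rewrite !exprMn -mulrDr gtr_pMr ?exprn_gt0//.
  by move: tsq0 tsq1 t2; move: (t ^+ 2) => u; nra.
(* The first coordinate alone already reaches the radius of the inner ball. *)
- rewrite /eball/=; apply/negP; rewrite -leNgt (le_trans xa)//.
  have := ler_coord_enorm (flat_point x y) 0; rewrite mxE/=.
  by rewrite ger0_norm.
Qed.
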